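(* Let $\mathfrak{l}$ be a reductive subalgebra of $\mathfrak{g}$, $\mathfrak{h}$ a Cartan subalgebra of $\mathfrak{g}$ such that $\mathfrak{h}_{\mathfrak{l}}:=\mathfrak{h}\cap\mathfrak{l}$ is a Cartan subalgebra of $\mathfrak{l}$, and $\mathfrak{p}$ a parabolic subalgebra of $\mathfrak{g}$ with $\mathfrak{h}\subseteq\mathfrak{p}$ such that $\mathfrak{p}\cap\mathfrak{l}$ is a parabolic subalgebra of $\mathfrak{l}$. Let $M$ be a $\mathfrak{g}$-module on which $\mathfrak{p}$ acts locally finitely, and let $M_1$ be a nonzero subquotient of $M$. Assume that $\eta|_{\mathfrak{h}_{\mathfrak{l}}}$ is non-integral relative to $\mathfrak{l}$ for all $\eta\in\mathrm{supp}_{\mathfrak{h}}M$. Then $\mathfrak{l}\not\subseteq\mathfrak{g}[M_1]$.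
   Context: $\mathfrak{g}$ is a finite-dimensional complex semisimple Lie algebra. For an $\mathfrak{h}$-module $M$ and $\omega\in\mathfrak{h}^*$, $M^\omega:=\{m\in M: hm=\omega(h)m\ \forall h\in\mathfrak{h}\}$ and $\mathrm{supp}_{\mathfrak{h}}M:=\{\omega\in\mathfrak{h}^*: M^\omega\neq0\}$. A weight of $\mathfrak{h}_{\mathfrak{l}}$ is integral relative to $\mathfrak{l}$ if it pairs integrally with every coroot of $\mathfrak{l}$ with respect to $\mathfrak{h}_{\mathfrak{l}}$. For a $\mathfrak{g}$-module $N$, $\mathfrak{g}[N]$ (the Fernando–Kac subalgebra) is the set of $x\in\mathfrak{g}$ acting locally finitely on $N$. *)

(* Defs.v *)
From HB Require Import structures.
From mathcomp Require Import all_boot all_order all_algebra.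
From mathcomp Require Import reals Rstruct complex.
Set Implicit Arguments. Unset Strict Implicit. Unset Printing Implicit Defensive.
Import Order.TTheory GRing.Theory Num.Theory.
Local Open Scope ring_scope.

Notation CC := (complex Rdefinitions.R).

Section LieAlgebras.
Variable g : vectType CC.
Variable br : g -> g -> g.

Definition lie_algebra : Prop :=
  [/\ forall (a : CC) (x y z : g), br (a *: x + y) z = a *: br x z + br y z,
      forall (a : CC) (x y z : g), br z (a *: x + y) = a *: br z x + br z y,
      forall x : g, br x x = 0 &
      forall x y z : g, br x (br y z) + br y (br z x) + br z (br x y) = 0].

Definition brv (A B : {vspace g}) : {vspace g} :=
  <<[seq br a b | a <- vbasis A, b <- vbasis B]>>%VS.

Definition subalgebra (A : {vspace g}) : Prop :=
  forall x y, x \in A -> y \in A -> br x y \in A.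

Definition ideal_in (L I : {vspace g}) : Prop :=
  (I <= L)%VS /\ forall x y, x \in L -> y \in I -> br x y \in I.

Definition derived_series (A : {vspace g}) (k : nat) : {vspace g} :=
  iter k (fun D => brv D D) A.
Definition solvable (A : {vspace g}) : Prop :=
  exists k, derived_series A k = 0%VS.

Definition lower_central_series (A : {vspace g}) (k : nat) : {vspace g} :=
  iter k (fun D => brv A D) A.
Definition nilpotent (A : {vspace g}) : Prop :=
  exists k, lower_central_series A k = 0%VS.

Definition semisimple : Prop :=
  forall I : {vspace g}, ideal_in fullv I -> solvable I -> I = 0%VS.

Definition cartan_in (L H : {vspace g}) : Prop :=
  [/\ (H <= L)%VS, subalgebra H, nilpotent H &
      forall x, x \in L -> (forall y, y \in H -> br x y \in H) -> x \in H].

Definition borel_in (L B : {vspace g}) : Prop :=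
  [/\ (B <= L)%VS, subalgebra B, solvable B &
      forall B' : {vspace g}, (B <= B')%VS -> (B' <= L)%VS ->
        subalgebra B' -> solvable B' -> B' = B].

Definition parabolic_in (L P : {vspace g}) : Prop :=
  [/\ (P <= L)%VS, subalgebra P & exists B, borel_in L B /\ (B <= P)%VS].

(* l is a reductive subalgebra of g (reductive in g): l is a subalgebra and
   g is a semisimple l-module under the adjoint action, i.e. every
   ad(l)-stable subspace of g has an ad(l)-stable complement. *)
Definition ad_stable (l V : {vspace g}) : Prop :=
  forall x v, x \in l -> v \in V -> br x v \in V.
Definition reductive_subalgebra (l : {vspace g}) : Prop :=
  subalgebra l /\
  forall V : {vspace g}, ad_stable l V ->
    exists W : {vspace g},
      [/\ ad_stable l W, (V :&: W = 0)%VS & (V + W = fullv)%VS].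

Definition rootvec (L H : {vspace g}) (alpha : g -> CC) (x : g) : Prop :=
  x \in L /\ forall y, y \in H -> br y x = alpha y *: x.

Definition is_coroot (L H : {vspace g}) (hal : g) : Prop :=
  exists alpha : g -> CC,
    [/\ exists y, y \in H /\ alpha y != 0,
        exists x, x != 0 /\ rootvec L H alpha x,
        exists xs ys : seq g,
          [/\ size xs = size ys,
              forall x, x \in xs -> rootvec L H alpha x,
              forall y, y \in ys -> rootvec L H (fun z => - alpha z) y &
              hal = \sum_(i < size xs) br xs`_i ys`_i] &
        alpha hal = 2].

(* A weight lambda of H (only its values on H matter) is integral relative to
   L if it pairs integrally with every coroot of L with respect to H. *)
Definition integral_rel (L H : {vspace g}) (lambda : g -> CC) : Prop :=
  forall hal, is_coroot L H hal -> exists z : int, lambda hal = z%:~R.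

Variable M : lmodType CC.
Variable act : g -> M -> M.

Definition lie_module : Prop :=
  [/\ forall (a : CC) (x y : g) (m : M), act (a *: x + y) m = a *: act x m + act y m,
      forall (a : CC) (x : g) (m n : M), act x (a *: m + n) = a *: act x m + act x n &
      forall (x y : g) (m : M), act (br x y) m = act x (act y m) - act y (act x m)].

Definition in_span (s : seq M) (v : M) : Prop :=
  exists c : 'I_(size s) -> CC, v = \sum_(i < size s) c i *: s`_i.

Definition submodule (N : M -> Prop) : Prop :=
  [/\ N 0, forall (a : CC) u v, N u -> N v -> N (a *: u + v) &
      forall x v, N v -> N (act x v)].

Definition locally_finite_on (P : {vspace g}) : Prop :=
  forall v : M, exists s : seq M,
    in_span s v /\ forall x w, x \in P -> in_span s w -> in_span s (act x w).

(* For submodules N1 <= N2 of M, x acts locally finitely on the subquotient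
   N2/N1: every vector of N2/N1 lies in a finite-dimensional x-stable subspace
   of N2/N1 (the image of the span of a finite s included in N2). *)
Definition locfin_elt_subquot (N1 N2 : M -> Prop) (x : g) : Prop :=
  forall v, N2 v -> exists s : seq M,
    [/\ forall w, w \in s -> N2 w,
        exists w, in_span s w /\ N1 (v - w) &
        forall w, in_span s w -> exists w', in_span s w' /\ N1 (act x w - w')].

Definition fernando_kac (N1 N2 : M -> Prop) (x : g) : Prop :=
  locfin_elt_subquot N1 N2 x.

(* eta (a function on g, of which only the restriction to H matters) lies in
   supp_H M: M^eta <> 0 *)
Definition in_supp (H : {vspace g}) (eta : g -> CC) : Prop :=
  exists m : M, m != 0 /\ forall x, x \in H -> act x m = eta x *: m.

End LieAlgebras.

(* Main.v *)
(* Since the nilpotent algebra h acts locally finitely on M, the subquotient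
   N2/N1 contains an h-weight vector, and its weight eta is also the weight of a
   genuine h-weight vector of M. Assume that l acts locally finitely on N2/N1.
   For x in a root space l^alpha and y in l^(-alpha), the vectors x and y act
   nilpotently on weight vectors, and the usual highest weight computation gives
   2 eta([x,y]) = z alpha([x,y]) for some integer z, depending on x and y. The
   bilinear form eta([x,y]) thus vanishes wherever alpha([x,y]) does, so the two
   forms are proportional and z can be chosen independently of x and y. As a
   coroot is a sum of brackets [x,y] on which alpha takes the value 2, eta takes
   the integer value z on it, for every coroot of l: a contradiction. *)
Require Import Defs.
From HB Require Import structures.
From mathcomp Require Import all_boot all_order all_algebra.
From mathcomp Require Import reals Rstruct complex ring.
From Stdlib Require Import Classical ClassicalEpsilon.
Set Implicit Arguments. Unset Strict Implicit. Unset Printing Implicit Defensive.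
Import Order.TTheory GRing.Theory Num.Theory.
Local Open Scope ring_scope.

(** * Linear algebra modulo a subspace of a possibly infinite-dimensional space *)

(** Such a predicate stands for a subspace that may have infinite dimension; [N u] is read as: [u]
    vanishes in the quotient by [N]. *)
Definition linear_pred {V : lmodType CC} (N : V -> Prop) : Prop :=
  N 0 /\ forall (a : CC) u v, N u -> N v -> N (a *: u + v).

Section LinearPred.
Variables (V : lmodType CC) (N : V -> Prop).
Hypothesis NP : linear_pred N.

Lemma lpredD u v : N u -> N v -> N (u + v).
Proof. by move=> Nu Nv; rewrite -[u]scale1r; apply: NP.2. Qed.

Lemma lpredZ a u : N u -> N (a *: u).
Proof. by move=> Nu; rewrite -[_ *: _]addr0; apply: NP.2 => //; exact: NP.1. Qed.

Lemma lpredN u : N u -> N (- u).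
Proof. by move=> Nu; rewrite -scaleN1r; exact: lpredZ. Qed.

Lemma lpredB u v : N u -> N v -> N (u - v).
Proof. by move=> Nu Nv; rewrite addrC -scaleN1r; apply: NP.2. Qed.

Lemma lpred_eqN u v : N (u - v) -> N v -> N u.
Proof. by move=> Nuv Nv; rewrite -(subrK v u); exact: lpredD. Qed.

Lemma lpredZ_eq a u : a != 0 -> N (a *: u) -> N u.
Proof. by move=> a0 /(lpredZ a^-1); rewrite scalerA mulVf // scale1r. Qed.

Lemma lpred_sum n (F : nat -> V) :
  (forall i, (i < n)%N -> N (F i)) -> N (\sum_(i < n) F i).
Proof.
elim: n => [|n IHn] NF; first by rewrite big_ord0; exact: NP.1.
rewrite big_ord_recr; apply: lpredD; last exact: NF.
by apply: IHn => i ltin; apply: NF; exact: ltnW.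
Qed.

(** The coordinates of the first [size s + 1] vectors form a matrix with more rows than columns, so
    some nonzero row vector kills it. Taking for [n] the last index with a nonzero coefficient makes
    the relation one of exact degree [n]. *)
Lemma dependent_mod (s : seq V) (v : nat -> V) :
  (forall i, exists2 w, in_span s w & N (v i - w)) ->
  exists n, exists2 c : nat -> CC, c n != 0 & N (\sum_(i < n.+1) c i *: v i).
Proof.
move=> hv.
have [C hC] : exists C : nat -> 'I_(size s) -> CC,
    forall i, N (v i - \sum_(j < size s) C i j *: s`_j).
  apply: (choice (fun i c => N (v i - \sum_(j < size s) c j *: s`_j))) => i.
  by have [w [c ->] Nw] := hv i; exists c.
pose A := \matrix_(i < (size s).+1, j < size s) C i j.
have kA0 : kermx A != 0.
  by rewrite kermx_eq0 /row_free neq_ltn ltnS rank_leq_col.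
have [u uA u0] := rowV0Pn kA0.
move/sub_kermxP: uA => uA.
pose c i := if insub i is Some j then u 0 j else 0.
have cE (i : 'I_(size s).+1) : c i = u 0 i by rewrite /c valK.
have Nsum : N (\sum_(i < (size s).+1) c i *: v i).
  have -> : \sum_(i < (size s).+1) c i *: v i =
      \sum_(i < (size s).+1) c i *: (v i - \sum_(j < size s) C i j *: s`_j).
    under [RHS]eq_bigr do rewrite scalerBr.
    rewrite sumrB -[LHS]subr0; congr (_ - _).
    under eq_bigr do rewrite scaler_sumr.
    rewrite exchange_big big1 //= => j _.
    under eq_bigr do rewrite scalerA.
    rewrite -scaler_suml.
    have := congr1 (fun B : 'rV__ => B 0 j) uA; rewrite !mxE => uAj.
    rewrite (eq_bigr (fun i => u 0 i * A i j)) ?uAj ?scale0r // => i _.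
    by rewrite cE mxE.
  apply: (@lpred_sum _ (fun i => c i *: (v i - \sum_(j < size s) C i j *: s`_j))).
  by move=> i _; exact: lpredZ.
have [i ci0] : exists i : 'I_(size s).+1, c i != 0.
  apply/existsP; apply: contraNT u0; rewrite negb_exists => /forallP c0.
  by apply/eqP/rowP => i; rewrite mxE -cE; apply/eqP; rewrite -[_ == _]negbK.
have [n ltn [cn0 cgt]] : exists2 n, (n < (size s).+1)%N &
    c n != 0 /\ forall j, (n < j < (size s).+1)%N -> c j = 0.
  have ex : exists n, (n < (size s).+1)%N && (c n != 0).
    by exists i; rewrite ltn_ord.
  have bd n : (n < (size s).+1)%N && (c n != 0) -> (n <= size s)%N by case/andP.
  case: (ex_maxnP ex bd) => n /andP[ltn cn0] nmax; exists n => //; split=> // j.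
  case/andP=> nj js; apply/eqP; apply: contraTT nj => cj0.
  by rewrite -leqNgt nmax // js.
exists n, c => //.
move: Nsum; rewrite -!(big_mkord xpredT (fun i => c i *: v i)).
rewrite (big_cat_nat _ (n := n.+1)) //= [X in _ + X]big_nat.
by rewrite [X in _ + X]big1 ?addr0 // => j /cgt->; rewrite scale0r.
Qed.

Variables (e f : {linear V -> V}).
Hypothesis eN : forall v, N v -> N (e v).

(* Applying [e] to a dependency among the [f ^ i v] lowers its degree,
   unless one of the [s k] vanishes. *)
Lemma highest_vector (v : V) (s : nat -> CC) :
  ~ N v -> N (e v) ->
  (forall k, N (e (iter k.+1 f v) - s k *: iter k f v)) ->
  (exists n, exists2 c : nat -> CC, c n != 0 &
     N (\sum_(i < n.+1) c i *: iter i f v)) ->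
  exists k, s k = 0.
Proof.
move=> Nv Nev es [n [c cn0 Nsum]]; apply: NNPP => /not_ex_all_not s0.
elim: n c cn0 Nsum => [|n IHn] c cn0.
  by rewrite big_ord1 => /(lpredZ_eq cn0).
move=> Nsum; apply: (IHn (fun i => c i.+1 * s i)).
  by rewrite mulf_neq0 //; apply/eqP/s0.
have := eN Nsum; rewrite big_ord_recl linearD linearZ linear_sum /= => Ne.
have {}Ne : N (\sum_(i < n.+1) e (c i.+1 *: iter i.+1 f v)).
  apply: lpred_eqN _ Ne; rewrite opprD addrCA subrr addr0.
  by apply/lpredN/lpredZ.
rewrite -[X in N X](subKr (\sum_(i < n.+1) e (c i.+1 *: iter i.+1 f v))).
apply: lpredB Ne _; rewrite -sumrB.
apply: (@lpred_sum _ (fun i => e (c i.+1 *: iter i.+1 f v) - (c i.+1 * s i) *: iter i f v)) => i _.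
by rewrite linearZ -scalerA -scalerBr; exact: lpredZ.
Qed.

(** Applying [e - a n] to the relation kills its last term and multiplies the others by the nonzero
    factors [a i - a n]; induct on the length. Since [u i] itself may lie in [N], the conclusion
    concerns the terms and not their coefficients. *)
Lemma eigen_independent (u : nat -> V) (a : nat -> CC) n (c : nat -> CC) :
  injective a -> (forall i, N (e (u i) - a i *: u i)) ->
  N (\sum_(i < n) c i *: u i) -> forall i, (i < n)%N -> N (c i *: u i).
Proof.
move=> a_inj eu; elim: n c => // n IHn c Nsum.
have Nlt i : (i < n)%N -> N (c i *: u i).
  move=> ltin; have aNa : a i - a n != 0.
    by rewrite subr_eq0; apply/eqP => /a_inj eq_in; rewrite eq_in ltnn in ltin.
  apply: (lpredZ_eq aNa); rewrite scalerA.
  apply: (IHn (fun i => (a i - a n) * c i)) => //.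
  have Ne := lpredB (eN Nsum) (lpredZ (a n) Nsum).
  rewrite linear_sum scaler_sumr -sumrB in Ne.
  apply: (lpred_eqN _ Ne).
  rewrite [X in _ - X]big_ord_recr opprD addrA -sumrB; apply: lpredB; last first.
    by rewrite linearZ /= scalerA [a n * _]mulrC -scalerA -scalerBr; exact: lpredZ.
  apply: (@lpred_sum _ (fun i => ((a i - a n) * c i) *: u i
     - (e (c i *: u i) - a n *: (c i *: u i)))) => j _.
  rewrite linearZ /= mulrBl scalerBl scalerA opprB addrA subrK -opprB.
  rewrite [a j * _]mulrC -scalerA -scalerBr.
  exact/lpredN/lpredZ.
move=> i; rewrite ltnS leq_eqVlt => /predU1P[->|]; last exact: Nlt.
move: Nsum; rewrite big_ord_recr /= addrC => Nsum.
by apply: (lpred_eqN _ Nsum); rewrite opprD addNKr;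
  apply/lpredN/(@lpred_sum _ (fun i => c i *: u i)).
Qed.

(** The relation says that [p(e) v] lies in [N] for some nonzero polynomial [p]. Over the complex
    numbers [p = q * ('X - a)]: either [q(e) v] is the eigenvector, or [q] replaces [p]. The vector
    is given as a combination of the [iter i e v] so that it stays in any [e]-stable subspace
    containing [v]. *)
Lemma eigenvector_mod (v : V) :
  ~ N v ->
  (exists n, exists2 c : nat -> CC, c n != 0 &
     N (\sum_(i < n.+1) c i *: iter i e v)) ->
  exists a, exists n, exists c : nat -> CC,
    let w := \sum_(i < n) c i *: iter i e v in ~ N w /\ N (e w - a *: w).
Proof.
move=> Nv [n [c cn0 Nsum]].
(* [ev k p] is [p(e) v] as soon as [k] is at least [size p]; the free bound [k] lets polynomials of
   different sizes be compared. *)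
pose ev k (p : {poly CC}) := \sum_(i < k) p`_i *: iter i e v.
have evE k (p : {poly CC}) : (size p <= k)%N -> ev k p = ev (size p) p.
  move=> lepk; rewrite /ev -!(big_mkord xpredT (fun i => p`_i *: iter i e v)).
  rewrite (big_cat_nat _ (n := size p)) //= [X in _ + X]big_nat.
  by rewrite [X in _ + X]big1 ?addr0 // => j /andP[pj _]; rewrite nth_default ?scale0r.
have [p p0 Np] : exists2 p : {poly CC}, p != 0 & N (ev (size p) p).
  exists (\poly_(i < n.+1) c i).
    by apply/eqP => /(congr1 (fun q : {poly CC} => q`_n));
      rewrite coef_poly ltnS leqnn coef0 => /eqP; apply/negP.
  rewrite -(evE n.+1) ?size_poly // /ev.
  by under eq_bigr => i _ do rewrite coef_poly ltn_ord.
have [m] := ubnP (size p); elim: m p p0 Np => // m IHm p p0 Np lepm.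
have szp : size p != 1.
  apply/eqP => szp; move: Np; rewrite /ev szp big_ord1 /=.
  move=> /lpredZ_eq-H; apply/Nv/H.
  by have := lead_coef_eq0 p; rewrite lead_coefE szp => ->.
have /closed_rootP[a /factor_theorem[q qE]] := szp.
have q0 : q != 0 by apply: contraNneq p0 => q0; rewrite qE q0 mul0r.
have szpq : size p = (size q).+1.
  by rewrite qE size_Mmonic ?monicXsubC // size_XsubC addn2.
have evq : ev (size p) p = e (ev (size q) q) - a *: ev (size q) q.
  have -> : ev (size p) p = ev (size p) (q * 'X) - a *: ev (size p) q.
    rewrite /ev scaler_sumr -sumrB; apply: eq_bigr => i _.
    by rewrite {1}qE mulrBr coefB coefMC scalerBl scalerA [a * _]mulrC.
  rewrite (evE _ q) ?szpq //; congr (_ - _).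
  rewrite /ev big_ord_recl coefMX scale0r add0r linear_sum.
  by apply: eq_bigr => i _; rewrite coefMX /= linearZ.
have [Nq|Nq] := classic (N (ev (size q) q)).
  by apply: (IHm q) => //; rewrite szpq in lepm.
exists a, (size q), (fun i => q`_i); split=> //.
by rewrite evq in Np.
Qed.

End LinearPred.

(** * Linear predicates on finite-dimensional spaces *)

Lemma linear_pred_mem (E : vectType CC) (U : {vspace E}) :
  linear_pred (fun u => u \in U).
Proof. by split=> [|a u v Uu Uv]; rewrite ?mem0v // memvD ?memvZ. Qed.

Lemma linear_pred_span (E : vectType CC) (P : E -> Prop) (X : seq E) :
  linear_pred P -> (forall x, x \in X -> P x) ->
  forall x, x \in <<X>>%VS -> P x.
Proof.
move=> PP PX x; rewrite -[X]/(in_tuple X : seq E) => /coord_span->.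
apply: big_ind => [|u v Pu Pv|i _]; first exact: PP.1.
  exact: lpredD.
by apply/(lpredZ PP)/PX/mem_nth.
Qed.

(** Enlarge a subspace contained in [P] by vectors of [P] still outside it; the codimension [n]
    bounds the number of enlargements. *)
Lemma linear_pred_vspace (E : vectType CC) (P : E -> Prop) :
  linear_pred P -> exists U : {vspace E}, forall u, u \in U <-> P u.
Proof.
move=> PP; suff ext n (U : {vspace E}) : (\dim {:E} - \dim U <= n)%N ->
    (forall u, u \in U -> P u) -> exists U : {vspace E}, forall u, u \in U <-> P u.
  apply: (ext (\dim {:E} - 0)%N 0%VS) => [|u]; first by rewrite dimv0.
  by rewrite memv0 => /eqP->; exact: PP.1.
elim: n U => [|n IHn] U dimU UP.
  exists U => u; split; first exact: UP.
  move=> _; suff -> : U = fullv by rewrite memvf.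
  by apply/eqP; rewrite eqEdim subvf -subn_eq0 -leqn0.
have [[u [Pu /negP uU]]|noext] := classic (exists u, P u /\ ~ u \in U); last first.
  exists U => u; split; first exact: UP.
  by move=> Pu; apply: NNPP => uU; apply: noext; exists u.
have UuP v : v \in (U + <[u]>)%VS -> P v.
  case/memv_addP => x xU [y /vlineP[a ->] ->].
  by apply: lpredD; [|exact: UP | exact: lpredZ].
apply: (IHn _ _ UuP).
have ltd : (\dim U < \dim (U + <[u]>)%VS)%N.
  rewrite ltn_neqAle dimvS ?addvSl // andbT; apply: contra uU => /eqP dU.
  have /eqP-> : U == (U + <[u]>)%VS by rewrite eqEdim addvSl dU leqnn.
  by rewrite (subvP (addvSr _ _)) ?memv_line.
have := dimvS (subvf (U + <[u]>)%VS); rewrite -ltnS => led.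
by rewrite -ltnS (leq_trans _ dimU) // ltn_sub2l // (leq_trans ltd).
Qed.

Lemma dependent_mod_fin (E : vectType CC) (N : E -> Prop) (v : nat -> E) :
  linear_pred N ->
  exists n, exists2 c : nat -> CC, c n != 0 & N (\sum_(i < n.+1) c i *: v i).
Proof.
move=> NP; apply: (dependent_mod NP (s := vbasis {:E})) => i.
exists (v i); last by rewrite subrr; exact: NP.1.
exists (fun j => coord (vbasis {:E}) (cast_ord (size_tuple _) j) (v i)).
rewrite {1}(coord_vbasis (memvf (v i))).
rewrite (reindex (cast_ord (size_tuple (vbasis {:E})))) //=.
by exists (cast_ord (esym (size_tuple (vbasis {:E})))) => j _;
  rewrite ?cast_ordK ?cast_ordKV.
Qed.

(** * Brackets and the lower central series *)

Section Bracket.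
Variables (g : vectType CC) (br : g -> g -> g).
Hypothesis br_lie : lie_algebra br.

Lemma brDl a x y z : br (a *: x + y) z = a *: br x z + br y z.
Proof. by case: br_lie. Qed.
Lemma brDr a x y z : br z (a *: x + y) = a *: br z x + br z y.
Proof. by case: br_lie. Qed.
Lemma br0l z : br 0 z = 0.
Proof.
by have := brDl (-1) 0 0 z; rewrite scaler0 addr0 scaleN1r addNr.
Qed.
Lemma br0r z : br z 0 = 0.
Proof.
by have := brDr (-1) 0 0 z; rewrite scaler0 addr0 scaleN1r addNr.
Qed.
Lemma br_antisym x y : br x y = - br y x.
Proof.
case: (br_lie) => _ _ brxx _; apply/eqP; rewrite -addr_eq0.
have := brxx (x + y); rewrite -{1}[x]scale1r brDl scale1r.
rewrite -[x in br x (x + y)]scale1r -[X in br _ (X + _)]scale1r !brDr !scale1r.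
by rewrite -[X in br _ (X + _)]scale1r brDr !brxx add0r addr0 scale1r => ->.
Qed.

(** [brv] is spanned by brackets of basis vectors only; linearity in one argument after the other
    reaches all brackets. *)
Lemma mem_brv (A B : {vspace g}) x y : x \in A -> y \in B -> br x y \in brv br A B.
Proof.
move=> Ax By; rewrite -(span_basis (vbasisP A)) in Ax.
apply: (linear_pred_span (P := fun x => br x y \in brv br A B) _ _ Ax).
  split=> [|a u v Pu Pv]; first by rewrite br0l mem0v.
  by rewrite brDl memvD ?memvZ.
move=> a Aa; rewrite -(span_basis (vbasisP B)) in By.
apply: (linear_pred_span (P := fun y => br a y \in brv br A B) _ _ By).
  split=> [|c u v Pu Pv]; first by rewrite br0r mem0v.
  by rewrite brDr memvD ?memvZ.
by move=> b Bb; apply: memv_span; apply/allpairsP; exists (a, b).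
Qed.

Lemma lower_central_sub (A : {vspace g}) k :
  subalgebra br A -> (lower_central_series br A k <= A)%VS.
Proof.
move=> subA; elim: k => [|k IHk]; first exact: subvv.
rewrite /lower_central_series /= -/(lower_central_series br A k).
apply/span_subvP => _ /allpairsP[[a b] /= [Aa Db ->]].
by apply: subA; [exact: vbasis_mem | apply: (subvP IHk); exact: vbasis_mem].
Qed.
End Bracket.

(** * Weights of finite-dimensional representations of a nilpotent Lie algebra *)

Section NilpotentRep.
Variables (g : vectType CC) (br : g -> g -> g) (h : {vspace g}).
Hypotheses (br_lie : lie_algebra br) (subh : subalgebra br h)
  (nilh : nilpotent br h).
Variables (E : vectType CC) (rho : g -> 'End(E)).
Hypothesis rho_br : forall x y u, x \in h -> y \in h ->
  rho (br x y) u = rho x (rho y u) - rho y (rho x u).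

Definition stable (U : {vspace E}) : Prop :=
  forall x u, x \in h -> u \in U -> rho x u \in U.

Lemma stable_iter U x u n : stable U -> x \in h -> u \in U -> iter n (rho x) u \in U.
Proof. by move=> sU hx Uu; elim: n => //= n; exact: sU. Qed.

(** Descend on the dimension. The minimality obtained makes the quotient of [W] by [W :&: P1]
    irreducible. *)
Lemma minimal_stable (P2 P1 : {vspace E}) :
  stable P2 -> ~~ (P2 <= P1)%VS ->
  exists W : {vspace E}, [/\ stable W, (W <= P2)%VS, ~~ (W <= P1)%VS &
    forall U : {vspace E}, stable U -> (U <= W)%VS -> ~~ (U <= P1)%VS -> U = W].
Proof.
have [n] := ubnP (\dim P2); elim: n P2 => // n IHn P2 ledim sP2 P21.
have [[U [sU UP2 UP1 neU]]|minP2] := classic (exists U : {vspace E},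
    [/\ stable U, (U <= P2)%VS, ~~ (U <= P1)%VS & U != P2]).
  have ltd : (\dim U < \dim P2)%N.
    rewrite ltn_neqAle dimvS // andbT; apply: contra neU => /eqP dUP.
    by rewrite eqEdim UP2 dUP /=.
  have [W [sW WU WP1 minW]] := IHn U (leq_trans ltd ledim) sU UP1.
  by exists W; split=> //; exact: subv_trans UP2.
exists P2; split=> // U sU UP2 UP1; apply/eqP/negPn/negP => neU.
by apply: minP2; exists U.
Qed.

(* The terms of the lower central series act by scalars on [W / W1], starting
   from the last one: if [z] acts with eigenvalue [a] and [[x, z]] acts as [b],
   then [x] and [z - a] satisfy Heisenberg relations, so [b = 0]; hence [z]
   commutes with [h] and its eigenspace is everything. *)
Lemma irreducible_scalar (W W1 : {vspace E}) :
  stable W -> stable W1 -> ~~ (W <= W1)%VS ->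
  (forall U : {vspace E}, stable U -> (U <= W)%VS -> ~~ (U <= W1)%VS ->
     U = W) ->
  exists eta : g -> CC, forall x w, x \in h -> w \in W -> rho x w - eta x *: w \in W1.
Proof.
move=> sW sW1 WW1 irr.
suff scal x : exists a, x \in h -> forall w, w \in W -> rho x w - a *: w \in W1.
  have [eta etaP] := choice _ scal; exists eta => x w hx; exact: etaP.
have [hx|nhx] := boolP (x \in h); last by exists 0 => hx; case/negP: nhx.
suff [a aP] : exists a, forall w, w \in W -> rho x w - a *: w \in W1 by exists a.
have [K nilK] := nilh.
pose D := lower_central_series br h.
(* As [j] grows, [D (K - j)] climbs from [D K = 0] to [D 0 = h]. *)
suff scalD j z : (j <= K)%N -> z \in D (K - j)%N ->
    exists a, forall w, w \in W -> rho z w - a *: w \in W1.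
  by apply: (scalD K) => //; rewrite subnn.
have W1P := linear_pred_mem W1.
elim: j z => [|j IHj] z ltjK.
  rewrite subn0 /D nilK memv0 => /eqP->; exists 0 => w _.
  (* [rho] is a bare function of its first argument, so [rho 0 = 0] is read off from the bracket
     relation at [[0, 0]]. *)
  have h0 : (0 : g) \in h := mem0v h.
  have := rho_br w h0 h0; rewrite subrr br0l // => ->.
  by rewrite scale0r subr0 mem0v.
move=> Dz; have hz : z \in h := subvP (lower_central_sub _ subh) _ Dz.
have [w0 Ww0 W1w0] : exists2 w, w \in W & ~ w \in W1.
  have /subvPn[w Ww W1w] := WW1; exists w => //; exact/negP.
have [a [n [c]]] := eigenvector_mod W1P W1w0
  (dependent_mod_fin (fun i => iter i (rho z) w0) W1P).
set w := \sum_(i < n) _ => -[W1w eigw].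
have Ww : w \in W by apply: memv_suml => i _; rewrite memvZ // stable_iter.
pose e : 'End(E) := (rho z - a *: \1)%VF.
have eE u : e u = rho z u - a *: u by rewrite add_lfunE opp_lfunE scale_lfunE id_lfunE.
have eW1 u : u \in W1 -> e u \in W1 by move=> W1u; rewrite eE memvB ?memvZ ?sW1.
have comm x0 : x0 \in h -> forall u, u \in W -> rho (br x0 z) u \in W1.
  move=> hx0.
  have [||b bP] := IHj (br x0 z); first exact: ltnW.
    by rewrite -(subnSK ltjK); exact: mem_brv.
  have bracket k : let u := iter k (rho x0) w in
      rho x0 (e u) - e (rho x0 u) - b *: u \in W1.
    rewrite /= !eE linearB linearZ /= opprB addrA subrK -rho_br //.
    exact/bP/stable_iter.
  suff b0 : b = 0 by move=> u Wu; have := bP u Wu; rewrite b0 scale0r subr0.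
  (* Moving [e] to the right past each of the [k + 1] factors [rho x0] contributes [- b]. In finite
     dimension [highest_vector] makes one of these coefficients vanish, so [b = 0]. *)
  have eraise k : e (iter k.+1 (rho x0) w) - (- (k.+1%:R * b)) *: iter k (rho x0) w \in W1.
    rewrite scaleNr opprK; elim: k => [|k IHk].
      have xew : rho x0 (e w) \in W1 by apply: sW1; rewrite ?eE.
      have := memvB xew (bracket 0); rewrite -addrA -opprD subKr.
      by rewrite mul1r.
    have := memvB (sW1 x0 _ hx0 IHk) (bracket k.+1).
    rewrite linearD linearZ -[_ - _ - _]addrA -opprD addrAC subKr -addrA -scalerDl.
    by rewrite -[k.+2%:R]natr1 mulrDl mul1r [b + _]addrC.
  have [k] : exists k, - (k.+1%:R * b) = 0.
    have ew : e w \in W1 by rewrite eE.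
    apply: (highest_vector W1P eW1 W1w ew eraise).
    exact: (dependent_mod_fin (fun i => iter i (rho x0) w) W1P).
  by move/eqP; rewrite oppr_eq0 mulf_eq0 pnatr_eq0 => /eqP.
exists a.
pose U := (W :&: (e @^-1: W1))%VS.
have UP u : (u \in U) = (u \in W) && (rho z u - a *: u \in W1).
  by rewrite memv_cap -memv_preim eE.
suff UW : U = W by move=> u; rewrite -UW UP => /andP[].
apply: irr.
- move=> x0 u hx0; rewrite !UP => /andP[Wu eu]; rewrite sW //=.
  have -> : rho z (rho x0 u) = rho x0 (rho z u) - rho (br x0 z) u.
    by rewrite rho_br // subKr.
  rewrite addrAC memvB ?comm //.
  by have := sW1 x0 _ hx0 eu; rewrite linearB linearZ.
- exact: capvSl.
- by apply/subvPn; exists w; [rewrite UP Ww | exact/negP].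
Qed.

(** From [T (y u) = y (T u) + [x, y] u], by a double induction: [[x, y]] lies one term deeper than
    [y] in the lower central series, and [T u] is killed by a smaller power of [T] than [u]. *)
Lemma gen_eigenspace_stable x y a u m :
  x \in h -> y \in h -> let T v := rho x v - a *: v in
  iter m T u = 0 -> exists n, iter n T (rho y u) = 0.
Proof.
move=> hx hy T; have [K nilK] := nilh.
pose D := lower_central_series br h.
have TD v w : T (v + w) = T v + T w by rewrite /T linearD scalerDr opprD addrACA.
have T0 : T 0 = 0 by rewrite /T linear0 scaler0 subr0.
have iterT0 n : iter n T 0 = 0 by elim: n => //= n ->.
have iterTD n v w : iter n T (v + w) = iter n T v + iter n T w.
  by elim: n => //= n ->; rewrite TD.
suff nilD j y' u' m' : (j <= K)%N -> y' \in D (K - j)%N -> iter m' T u' = 0 ->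
    exists n, iter n T (rho y' u') = 0.
  by apply: (nilD K) => //; rewrite subnn.
clear u m y hy; elim: j y' u' m' => [|j IHj] y u m ltjK.
  rewrite subn0 /D nilK memv0 => /eqP-> _; exists 0.
  have h0 : (0 : g) \in h := mem0v h.
  by have := rho_br u h0 h0; rewrite subrr br0l.
move=> Dy; have hy : y \in h := subvP (lower_central_sub _ subh) _ Dy.
elim: m u => [|m IHm] u; first by move=> /= ->; exists 0; rewrite linear0.
rewrite iterSr => mu.
have [n1 n1P] := IHm _ mu.
have [n2 n2P] : exists n, iter n T (rho (br x y) u) = 0.
  apply: (IHj _ u m.+1 (ltnW ltjK)); last by rewrite iterSr.
  by rewrite -(subnSK ltjK); exact: mem_brv.
exists (n1 + n2).+1; rewrite iterSr.
have -> : T (rho y u) = rho y (T u) + rho (br x y) u.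
  by rewrite rho_br // [T u]/T (linearB (rho y)) (linearZ_LR (rho y)) /T /= [RHS]addrC addrA subrK.
by rewrite iterTD {1}addnC !iterD n1P n2P !iterT0 addr0.
Qed.
(* Take [W] minimal among the stable subspaces of [P2] not inside [P1]: then
   [W / (W :&: P1)] is a line, of weight [eta] say. The generalized
   [eta]-eigenspace in [W] of each [x] is stable and not inside [P1], so it is
   [W]; any weight vector of [W] therefore has weight [eta]. *)
Lemma common_weight (P1 P2 : {vspace E}) :
  stable P1 -> stable P2 -> ~~ (P2 <= P1)%VS ->
  exists eta : g -> CC,
    (exists2 u, u != 0 & forall x, x \in h -> rho x u = eta x *: u) /\
    (exists2 w, w \in P2 /\ ~ w \in P1 &
       forall x, x \in h -> rho x w - eta x *: w \in P1).
Proof.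
move=> sP1 sP2 P21.
have [W [sW WP2 WP1 minW]] := minimal_stable sP2 P21.
have [eta etaP] : exists eta : g -> CC,
    forall x w, x \in h -> w \in W -> rho x w - eta x *: w \in P1.
  by apply: irreducible_scalar => // U sU; exact: minW.
have /subvPn[w Ww P1w] := WP1.
(* The same argument with [0] in place of [P1] yields a genuine weight vector [u] in [W], of weight
   [lam]; what remains is [lam = eta] on [h]. *)
have stable0 : stable 0%VS.
  by move=> x u _; rewrite !memv0 => /eqP->; rewrite linear0.
have W0 : ~~ (W <= 0)%VS.
  by apply: contra WP1 => W0; apply: (subv_trans W0); exact: sub0v.
have [V [sV VW V0 minV]] := minimal_stable sW W0.
have [lam lamP] : exists lam : g -> CC,
    forall x v, x \in h -> v \in V -> rho x v - lam x *: v \in 0%VS.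
  by apply: irreducible_scalar => // U sU; exact: minV.
have /subvPn[u Vu] := V0; rewrite memv0 => u0.
have rhou x : x \in h -> rho x u = lam x *: u.
  by move=> hx; apply/eqP; rewrite -subr_eq0 -memv0 lamP.
exists eta; split; last first.
  by exists w => [|x hx]; [split; [exact: (subvP WP2) | exact/negP] | exact: etaP].
exists u => // x hx; rewrite rhou //; congr (_ *: _).
pose T : 'End(E) := (rho x - eta x *: \1)%VF.
have TE v : T v = rho x v - eta x *: v.
  by rewrite add_lfunE opp_lfunE scale_lfunE id_lfunE.
pose nil v := exists n, iter n T v = 0.
have iterT n : {morph iter n T : a b / a + b} by elim: n => // n IHn a b /=; rewrite IHn linearD.
have iterTZ n a v : iter n T (a *: v) = a *: iter n T v.
  by elim: n => //= n ->; rewrite linearZ.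
have iterT0 n : iter n T 0 = 0 by elim: n => //= n ->; rewrite linear0.
have nilP : linear_pred nil.
  split=> [|a v v' [n nv] [n' nv']]; first by exists 0.
  exists (n + n')%N; rewrite iterT iterTZ {1}addnC !iterD nv nv' !iterT0.
  by rewrite scaler0 addr0.
have [K KP] : exists K : {vspace E}, forall v, v \in K <-> (v \in W /\ nil v).
  apply: linear_pred_vspace; split=> [|a v v' [Wv nv] [Wv' nv']].
    by split; [exact: mem0v | exact: nilP.1].
  by split; [rewrite memvD ?memvZ | exact: nilP.2].
have TW v : v \in W -> T v \in W by move=> Wv; rewrite TE memvB ?memvZ ?sW.
have TP1 v : v \in W -> T v \in P1 by move=> Wv; rewrite TE etaP.
have KW : K = W.
  apply: minW; first 2 last.
  - suff [v Kv P1v] : exists2 v, v \in K & v \notin P1 by apply/subvPn; exists v.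
    (* Some nonzero polynomial in [T] sends [w] into [nil]. If its constant term is zero, a factor
       [T] can be cancelled. Otherwise the image of [w] is a nonzero multiple of [w] modulo [P1],
       because [T] maps [W] into [P1], so it lies in [K] but outside [P1]. *)
    have [n [c cn0 Nsum]] := dependent_mod_fin (fun i => iter i T w) nilP.
    elim: n c cn0 Nsum => [|n IHn] c cn0 Nsum.
      exists w => //; apply/KP; split=> //.
      by move: Nsum; rewrite big_ord1; exact: (lpredZ_eq nilP).
    have WT i : iter i T w \in W by elim: i => //= i; exact: TW.
    move: Nsum; rewrite big_ord_recl.
    set v := \sum_(i < n.+1) c i.+1 *: iter i T w.
    have Wv : v \in W by apply: memv_suml => i _; rewrite memvZ.
    have -> : \sum_(i < n.+1) c (bump 0 i) *: iter (bump 0 i) T w = T v.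
      by rewrite linear_sum; apply: eq_bigr => i _; rewrite linearZ.
    have [c0|c0] := eqVneq (c 0%N) 0.
      rewrite c0 scale0r add0r => -[k kTv]; apply: (IHn (fun i => c i.+1)) => //.
      by exists k.+1; rewrite iterSr.
    move=> nsum; exists (c 0%N *: w + T v).
      by apply/KP; split; rewrite ?memvD ?memvZ ?TW.
    apply: contra P1w => P1sum.
    have := memvB P1sum (TP1 _ Wv); rewrite addrK => /(memvZ (c 0%N)^-1).
    by rewrite scalerA mulVf // scale1r.
  - move=> y v hy /KP[Wv [m mv]]; apply/KP; split; first exact: sW.
    have eT n v' : iter n T v' = iter n (fun v => rho x v - eta x *: v) v'.
      by elim: n => //= n ->.
    have [n nv] := @gen_eigenspace_stable x y (eta x) v m hx hy (etrans (esym (eT _ _)) mv).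
    by exists n; rewrite eT.
  - by apply/subvP => v /KP[].
have Wu : u \in W by exact: (subvP VW).
have [n] : nil u by move: Wu; rewrite -KW => /KP[].
have -> : iter n T u = (lam x - eta x) ^+ n *: u.
  elim: n => [|n IHn] /=; first by rewrite scale1r.
  by rewrite IHn linearZ /= TE rhou //= -scalerBl scalerA exprSr.
move/eqP; rewrite scaler_eq0 (negPf u0) orbF expf_eq0 subr_eq0.
by case/andP=> _ /eqP.
Qed.
End NilpotentRep.

(** * From locally finite modules to finite-dimensional representations *)

Lemma linear_fun_of (V W : lmodType CC) (f : V -> W) :
  (forall (a : CC) u v, f (a *: u + v) = a *: f u + f v) ->
  exists F : {linear V -> W}, forall v, F v = f v.
Proof.
move=> flin.
pose F : {linear V -> W} := HB.pack f (GRing.isLinear.Build CC V W *:%R f flin).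
by exists F.
Qed.

Section Modules.
Variables (g : vectType CC) (br : g -> g -> g) (M : lmodType CC) (act : g -> M -> M).
Hypotheses (br_lie : lie_algebra br) (act_lie : lie_module br act).

Lemma actDl a x y m : act (a *: x + y) m = a *: act x m + act y m.
Proof. by case: act_lie. Qed.
Lemma actDr a x m n : act x (a *: m + n) = a *: act x m + act x n.
Proof. by case: act_lie. Qed.
Lemma act_br x y m : act (br x y) m = act x (act y m) - act y (act x m).
Proof. by case: act_lie. Qed.
Lemma actZl a x m : act (a *: x) m = a *: act x m.
Proof.
have act0 : act 0 m = 0.
  by have := actDl (-1) 0 0 m; rewrite scaler0 addr0 scaleN1r addNr.
by rewrite -[a *: x]addr0 actDl act0 addr0.
Qed.
Lemma actZr a x m : act x (a *: m) = a *: act x m.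
Proof.
have act0 : act x 0 = 0.
  by have := actDr (-1) x 0 0; rewrite scaler0 addr0 scaleN1r addNr.
by rewrite -[a *: m]addr0 actDr act0 addr0.
Qed.
Lemma actB x m n : act x (m - n) = act x m - act x n.
Proof. by rewrite addrC -scaleN1r actDr scaleN1r addrC. Qed.

Lemma submodule_linear_pred (N : M -> Prop) : submodule act N -> linear_pred N.
Proof. by case=> N0 ND _; split. Qed.

Lemma submodule_iter (N : M -> Prop) x v i :
  submodule act N -> N v -> N (iter i (act x) v).
Proof. by case=> _ _ Nact Nv; elim: i => //= i; exact: Nact. Qed.

(** An [h]-stable finite span containing [v] is modelled by a finite-dimensional space [E], to which
    [N1] and [N2] are pulled back; [common_weight] then gives one weight occurring both in [M] and
    in the subquotient. *)
Lemma subquotient_weight (h : {vspace g}) (N1 N2 : M -> Prop) :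
  subalgebra br h -> nilpotent br h -> locally_finite_on act h ->
  submodule act N1 -> submodule act N2 -> (exists v, N2 v /\ ~ N1 v) ->
  exists2 eta, in_supp act h eta &
    exists2 w, N2 w /\ ~ N1 w & forall x, x \in h -> N1 (act x w - eta x *: w).
Proof.
move=> subh nilh hfin subN1 subN2 [v [N2v N1v]].
have [s [sv hs]] := hfin v.
have N1P := submodule_linear_pred subN1.
have [phi0 phi0E] : exists F : {linear 'rV[CC]_(size s) -> M},
    forall c, F c = \sum_(i < size s) c 0 i *: s`_i.
  apply: linear_fun_of => a c d; rewrite scaler_sumr -big_split /=.
  by apply: eq_bigr => i _; rewrite !mxE scalerDl scalerA.
have [U UP] : exists U : {vspace 'rV[CC]_(size s)}, forall c, c \in U <-> phi0 c = 0.
  apply: linear_pred_vspace; split=> [|a c d pc pd]; first by rewrite linear0.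
  by rewrite linearP pc pd scaler0 addr0.
(* [U] consists of the linear relations among [s], so [phi] identifies its complement with the span
   of [s]. *)
pose E : vectType CC := subvs_of (U^C)%VS.
have [phi phiE] : exists F : {linear E -> M}, forall e, F e = phi0 (vsval e).
  by apply: linear_fun_of => a c d; rewrite !linearP.
have phi_inj e : phi e = 0 -> e = 0.
  rewrite phiE => /UP Ue; apply/val_inj/eqP; rewrite -memv0 -(capv_compl U).
  by rewrite memv_cap Ue subvsP.
have phiI : injective phi.
  by move=> e e' ee'; apply/eqP; rewrite -subr_eq0; apply/eqP/phi_inj; rewrite linearB ee' subrr.
have phi_span e : in_span s (phi e) by rewrite phiE phi0E; exists (fun i => vsval e 0 i).
have span_phi m : in_span s m -> exists e, phi e = m.
  case=> c ->; pose d : 'rV[CC]_(size s) := \row_i c i.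
  have : d \in (U + U^C)%VS by rewrite addv_complf memvf.
  case/memv_addP => a Ua [b Ub dab]; exists (Subvs Ub).
  transitivity (phi0 d); last by rewrite phi0E; apply: eq_bigr => i _; rewrite mxE.
  by rewrite phiE dab linearD (UP a).1 ?add0r.
(* [rho x] is the action of [x] on the span of [s] read through [phi]; outside [h] the span need not
   be stable, and the value is set to 0. *)
have [rho rhoE] : exists rho : g -> 'End(E),
    forall x, x \in h -> forall e, phi (rho x e) = act x (phi e).
  apply: (choice (fun x (F : 'End(E)) => x \in h -> forall e, phi (F e) = act x (phi e))) => x.
  have [hx|nhx] := boolP (x \in h); last by exists 0 => hx; case/negP: nhx.
  have [f fE] : exists f : E -> E, forall e, phi (f e) = act x (phi e).
    by apply: (choice (fun e e' => phi e' = act x (phi e))) => e; apply/span_phi/hs.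
  have [F FE] : exists F : {linear E -> E}, forall e, F e = f e.
    apply: linear_fun_of => a c d; apply: phiI.
    by rewrite linearP !fE linearP actDr.
  by exists (linfun F) => _ e; rewrite lfunE /= FE.
have rho_br x y u : x \in h -> y \in h ->
    rho (br x y) u = rho x (rho y u) - rho y (rho x u).
  move=> hx hy; apply: phiI.
  by rewrite linearB !rhoE ?subh // act_br.
have pull (N : M -> Prop) : submodule act N ->
    exists2 P : {vspace E}, stable h rho P & forall e, e \in P <-> N (phi e).
  move=> subN; have NP := submodule_linear_pred subN.
  have [P PP] : exists P : {vspace E}, forall e, e \in P <-> N (phi e).
    apply: linear_pred_vspace; split=> [|a c d Nc Nd].
      by rewrite linear0; exact: NP.1.
    by rewrite linearP; exact: NP.2.
  exists P => // x e hx /PP Ne; apply/PP; rewrite rhoE //.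
  by case: subN => _ _; apply.
have [P1 sP1 P1E] := pull _ subN1.
have [P2 sP2 P2E] := pull _ subN2.
have P21 : ~~ (P2 <= P1)%VS.
  have [e ev] := span_phi v sv; apply/subvPn; exists e.
    by apply/P2E; rewrite ev.
  by apply/negP => /P1E; rewrite ev.
have [eta [[u u0 ueta] [w [P2w P1w] weta]]] :=
  common_weight br_lie subh nilh rho_br sP1 sP2 P21.
exists eta.
  exists (phi u); split; first by apply: contraNneq u0 => /phi_inj ->.
  by move=> x hx; rewrite -rhoE // ueta // linearZ.
exists (phi w); first by split; [exact/P2E | move/P1E].
by move=> x hx; rewrite -rhoE // -linearZ -linearB; apply/P1E/weta.
Qed.

(** * Root vectors acting on a weight vector of the subquotient *)

Section SubquotientWeights.
Variables (N1 N2 : M -> Prop).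
Hypotheses (subN1 : submodule act N1) (subN2 : submodule act N2).

(** Modulo [N1], all iterates of [v] under [x] stay in one finite span. *)
Lemma locfin_dependent x v :
  locfin_elt_subquot act N1 N2 x -> N2 v ->
  exists n, exists2 c : nat -> CC,
    c n != 0 & N1 (\sum_(i < n.+1) c i *: iter i (act x) v).
Proof.
move=> xfin N2v; have [s [_ [w [sw N1w]] sx]] := xfin v N2v.
have N1P := submodule_linear_pred subN1.
apply: (dependent_mod N1P (s := s)) => i.
elim: i => [|i [u su N1u]]; first by exists w.
have [u' [su' N1u']] := sx u su; exists u' => //=.
rewrite -(subrK (act x u) (act x _)) -actB -addrA; apply: (lpredD N1P) => //.
by case: subN1 => _ _; apply.
Qed.

Variable H : {vspace g}.

Lemma weight_shift (beta mu : g -> CC) x v i t :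
  (forall t, t \in H -> br t x = beta t *: x) ->
  (forall t, t \in H -> N1 (act t v - mu t *: v)) ->
  t \in H ->
  N1 (act t (iter i (act x) v) - (mu t + i%:R * beta t) *: iter i (act x) v).
Proof.
move=> xbeta vmu Ht; have N1P := submodule_linear_pred subN1.
elim: i => [|i IHi]; first by rewrite mul0r addr0; exact: vmu.
rewrite /=; set u := iter i _ v in IHi *.
have -> : act t (act x u) = act x (act t u) + beta t *: act x u.
  by rewrite -actZl -xbeta // act_br addrC subrK.
have -> : mu t + i.+1%:R * beta t = beta t + (mu t + i%:R * beta t) by rewrite -natr1; ring.
rewrite scalerDl opprD addrA addrK -actZr -actB.
by case: subN1 => _ _; apply.
Qed.

(* When [alpha (br x y) != 0] this is the theory of sl2; when it vanishes the
   same computation, in a Heisenberg algebra, shows [eta (br x y) = 0]. *)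
Lemma coroot_pairing (alpha eta : g -> CC) x y w :
  (forall t, t \in H -> br t x = alpha t *: x) ->
  (forall t, t \in H -> br t y = - alpha t *: y) ->
  br x y \in H -> (exists2 t, t \in H & alpha t != 0) ->
  locfin_elt_subquot act N1 N2 x -> locfin_elt_subquot act N1 N2 y ->
  N2 w -> ~ N1 w ->
  (forall t, t \in H -> N1 (act t w - eta t *: w)) ->
  exists z : int, 2 * eta (br x y) = z%:~R * alpha (br x y).
Proof.
move=> xal yal Hs [t0 Ht0 al0] xfin yfin N2w N1w weta.
have N1P := submodule_linear_pred subN1.
have N1act t v : N1 v -> N1 (act t v) by case: subN1 => _ _ Nact; exact: Nact.
have [X XE] := linear_fun_of (actDr ^~ x).
have [Y YE] := linear_fun_of (actDr ^~ y).
have [T TE] := linear_fun_of (actDr ^~ t0).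
have XN1 v : N1 v -> N1 (X v) by rewrite XE; exact: N1act.
have TN1 v : N1 v -> N1 (T v) by rewrite TE; exact: N1act.
have iterY i v : iter i Y v = iter i (act y) v by elim: i => //= i ->.
pose u i := iter i (act x) w.
(* The [u i] have pairwise distinct weights at [t0], so each term of a relation among them lies in
   [N1]; the one with nonzero leading coefficient shows that [x] is nilpotent on [w]. *)
have [i N1u] : exists i, N1 (u i).
  have [n [c cn0 Nsum]] := locfin_dependent xfin N2w.
  exists n; apply: (lpredZ_eq N1P cn0).
  apply: (eigen_independent (u := u) (a := fun i => eta t0 + i%:R * alpha t0) N1P TN1 _ _ Nsum) => //.
    by move=> i j /addrI/(mulIf al0)/eqP; rewrite eqr_nat => /eqP.
  by move=> i; rewrite TE; exact: weight_shift.
have [j N1uj N1uj1] : exists2 j, ~ N1 (u j) & N1 (u j.+1).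
  elim: i N1u => // i IHi N1u.
  by have [/IHi //|N1i] := classic (N1 (u i)); exists i.
set v0 := u j in N1uj.
pose mu t := eta t + j%:R * alpha t.
have v0mu t : t \in H -> N1 (act t v0 - mu t *: v0) by exact: weight_shift.
set s := br x y in Hs *.
(* The usual sl2 formula, with [alpha s] left arbitrary instead of normalised to 2. *)
have raise k : N1 (X (iter k.+1 Y v0) -
    (k.+1%:R * (mu s - k%:R / 2 * alpha s)) *: iter k Y v0).
  have XYs v : X (Y v) = Y (X v) + act s v.
    by rewrite !XE !YE /s act_br addrC subrK.
  have shift k' : N1 (act s (iter k' Y v0) - (mu s + k'%:R * - alpha s) *: iter k' Y v0).
    rewrite iterY; exact: (weight_shift (beta := fun t => - alpha t)).
  elim: k => [|k IHk].
    rewrite /= XYs -addrA; apply: (lpredD N1P).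
      by rewrite YE; apply: N1act; rewrite XE.
    have := shift 0%N; rewrite /= !mul0r addr0 subr0 mul1r; exact.
  rewrite iterS XYs.
  have -> : k.+2%:R * (mu s - k.+1%:R / 2 * alpha s) =
      k.+1%:R * (mu s - k%:R / 2 * alpha s) + (mu s + k.+1%:R * - alpha s).
    by rewrite -[k.+2%:R]natr1 -[k.+1%:R]natr1; field.
  rewrite scalerDl opprD addrACA; apply: (lpredD N1P); last exact: shift.
  by rewrite [iter k.+1 Y v0 in X in _ - X]iterS -linearZ -linearB YE; exact: N1act.
have N2v0 : N2 v0 by exact: submodule_iter.
have [k /eqP] : exists k, k.+1%:R * (mu s - k%:R / 2 * alpha s) = 0.
  apply: (highest_vector N1P XN1 N1uj _ raise); first by rewrite XE.
  have [n [c cn0 Nsum]] := locfin_dependent yfin N2v0.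
  exists n, c => //; move: Nsum; congr N1; apply: eq_bigr => i' _.
  by rewrite iterY.
rewrite mulf_eq0 pnatr_eq0 /= subr_eq0 => /eqP muE.
(* The vanishing coefficient gives [mu s = k / 2 * alpha s], while [eta s = mu s - j * alpha s]. *)
exists (k%:Z - (2 * j)%:Z); rewrite intrB -!pmulrn natrM.
have -> : eta s = mu s - j%:R * alpha s by rewrite /mu addrK.
by rewrite muE; field.
Qed.
End SubquotientWeights.
End Modules.

(** * Proportionality of bilinear forms *)

Section Proportional.
Variables (V : lmodType CC) (X Y : V -> Prop) (A B : V -> V -> CC).
Hypotheses (XP : linear_pred X) (YP : linear_pred Y).
Hypotheses
  (AX : forall a x x' y, X x -> X x' -> Y y -> A (a *: x + x') y = a * A x y + A x' y)
  (AY : forall a x y y', X x -> Y y -> Y y' -> A x (a *: y + y') = a * A x y + A x y')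
  (BX : forall a x x' y, X x -> X x' -> Y y -> B (a *: x + x') y = a * B x y + B x' y)
  (BY : forall a x y y', X x -> Y y -> Y y' -> B x (a *: y + y') = a * B x y + B x y').

(** With one argument fixed, a linear form vanishing on the kernel of another nonzero one is a
    multiple of it. The ratio thus passes from [(x0, y0)] to [(x, y0)] and on to [(x, y)] whenever
    [B x y0] is nonzero. *)
Lemma bilinear_proportional x0 y0 :
  (forall x y, X x -> Y y -> B x y = 0 -> A x y = 0) ->
  X x0 -> Y y0 -> B x0 y0 != 0 ->
  forall x y, X x -> Y y -> A x y = A x0 y0 / B x0 y0 * B x y.
Proof.
move=> BA X0 Y0 B0.
have inY x y y' : X x -> Y y -> Y y' -> B x y != 0 -> A x y' = A x y / B x y * B x y'.
  move=> Xx Yy Yy' Bxy.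
  have Ya : Y (- (B x y' / B x y) *: y + y') by exact: YP.2.
  have /(BA _ _ Xx Ya) : B x (- (B x y' / B x y) *: y + y') = 0.
    by rewrite BY // mulNr divfK // addNr.
  by rewrite AY // mulNr addrC => /eqP; rewrite subr_eq0 => /eqP->; field.
have inX x x' y : X x -> X x' -> Y y -> B x y != 0 -> A x' y = A x y / B x y * B x' y.
  move=> Xx Xx' Yy Bxy.
  have Xa : X (- (B x' y / B x y) *: x + x') by exact: XP.2.
  have /(BA _ _ Xa Yy) : B (- (B x' y / B x y) *: x + x') y = 0.
    by rewrite BX // mulNr divfK // addNr.
  by rewrite AX // mulNr addrC => /eqP; rewrite subr_eq0 => /eqP->; field.
have nz x y : X x -> Y y -> B x y0 != 0 -> A x y = A x0 y0 / B x0 y0 * B x y.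
  by move=> Xx Yy Bx; rewrite (inY x y0) // (inX x0 x y0) // mulfK.
(* If [B x y0 = 0], use [x + x0] instead of [x] and subtract the identity for [x0]. *)
move=> x y Xx Yy; have [Bx|] := eqVneq (B x y0) 0; last exact: nz.
have Xs : X (1 *: x + x0) by exact: XP.2.
have := nz _ _ Xs Yy; rewrite !AX ?BX // Bx !mul1r add0r B0 => /(_ isT).
by rewrite mulrDr (inY x0 y0 y) // => /addIr.
Qed.
End Proportional.

(** * Integrality of the weight on every coroot *)

Theorem theorem1 (g : vectType CC) (br : g -> g -> g)
    (M : lmodType CC) (act : g -> M -> M)
    (l h p : {vspace g}) (N1 N2 : M -> Prop) :
  lie_algebra br -> semisimple br ->
  lie_module br act ->
  reductive_subalgebra br l ->
  cartan_in br fullv h ->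
  cartan_in br l (h :&: l)%VS ->
  parabolic_in br fullv p -> (h <= p)%VS ->
  parabolic_in br l (p :&: l)%VS ->
  locally_finite_on act p ->
  (* M1 = N2 / N1 is a nonzero subquotient of M *)
  submodule act N1 -> submodule act N2 -> (forall v, N1 v -> N2 v) ->
  (exists v, N2 v /\ ~ N1 v) ->
  (forall eta, in_supp act h eta -> ~ integral_rel br l (h :&: l)%VS eta) ->
  ~ (forall x, x \in l -> fernando_kac act N1 N2 x).
Proof.
move=> br_lie _ act_lie [subl _] [_ subh nilh _] [_ _ _ normH] _ hp _ pfin.
move=> subN1 subN2 _ N12 nonint lfin.
have hfin : locally_finite_on act h.
  by move=> v; have [s [sv sP]] := pfin v; exists s; split=> // x w /(subvP hp); exact: sP.
have [eta eta_supp [w [N2w N1w] weta]] :=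
  subquotient_weight br_lie act_lie subh nilh hfin subN1 subN2 N12.
apply: (nonint eta eta_supp) => hal [alpha [[t0 [Ht0 al0]] [e [e0 [_ ealpha]]] [xs [ys [sz xsP ysP halE]]] halpha2]].
set H := (h :&: l)%VS in normH Ht0 ealpha xsP ysP *.
have Hh t : t \in H -> t \in h by rewrite memv_cap => /andP[].
(* [alpha] and [eta] are bare functions; their linearity on [H] comes from the nonzero vectors [e]
   and [m] on which [H] acts through them. *)
have alphaD a t t' : t \in H -> t' \in H -> alpha (a *: t + t') = a * alpha t + alpha t'.
  move=> Ht Ht'; have := ealpha (a *: t + t'); rewrite memvD ?memvZ // => /(_ isT).
  rewrite brDl // !ealpha // scalerA -scalerDl => /eqP.
  by rewrite -subr_eq0 -scalerBl scaler_eq0 (negPf e0) orbF subr_eq0 eq_sym => /eqP.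
have etaD a t t' : t \in H -> t' \in H -> eta (a *: t + t') = a * eta t + eta t'.
  case: eta_supp => m [m0 meta] /Hh ht /Hh ht'.
  have := meta (a *: t + t'); rewrite memvD ?memvZ // => /(_ isT).
  rewrite (actDl act_lie) !meta // scalerA -scalerDl => /eqP.
  by rewrite -subr_eq0 -scalerBl scaler_eq0 (negPf m0) orbF subr_eq0 eq_sym => /eqP.
pose X := rootvec br l H alpha; pose Y := rootvec br l H (fun z => - alpha z).
have rootP beta : linear_pred (rootvec br l H beta).
  split=> [|a x x' [lx xb] [lx' xb']].
    by split=> [|t _]; rewrite ?mem0v // br0r // scaler0.
  split=> [|t Ht]; first by rewrite memvD ?memvZ.
  by rewrite brDr // xb // xb' // scalerDr !scalerA mulrC.
(* By the Jacobi identity the weights [alpha] and [- alpha] cancel, so [br x y] commutes with [H];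
   being in [l], it lies in the self-normalising [H]. *)
have XYH x y : X x -> Y y -> br x y \in H.
  move=> [lx xal] [ly yal]; apply: normH; first exact: subl.
  move=> t Ht; suff -> : br (br x y) t = 0 by exact: mem0v.
  rewrite br_antisym //; apply/eqP; rewrite oppr_eq0; apply/eqP.
  case: (br_lie) => _ _ _ /(_ t x y).
  rewrite (br_antisym br_lie y t) (yal t) // (xal t) // scaleNr opprK.
  have brZ a u v : br u (a *: v) = a *: br u v.
    by rewrite -[a *: v]addr0 brDr // br0r // addr0.
  by rewrite !brZ (br_antisym br_lie y x) scalerN -addrA subrr addr0.
have pairing x y : X x -> Y y ->
    exists z : int, 2 * eta (br x y) = z%:~R * alpha (br x y).
  move=> Xx Yy; have [[lx xal] [ly yal]] := (Xx, Yy).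
  apply: (coroot_pairing act_lie subN1 subN2 (H := H) (w := w)) => //.
  - exact: XYH.
  - by exists t0.
  - exact: lfin.
  - exact: lfin.
  - by move=> t /Hh; exact: weta.
have sumH (F : g -> CC) (v : nat -> g) n :
    (forall a t t', t \in H -> t' \in H -> F (a *: t + t') = a * F t + F t') ->
    (forall i, (i < n)%N -> v i \in H) ->
    F (\sum_(i < n) v i) = \sum_(i < n) F (v i).
  move=> FD; elim: n => [|n IHn] vH.
    rewrite !big_ord0.
    by have := FD (-1) 0 0 (mem0v H) (mem0v H); rewrite scaler0 addr0 mulN1r addNr.
  rewrite !big_ord_recr /= addrC -[v n]scale1r FD ?vH //.
    by rewrite mul1r IHn ?scale1r 1?addrC // => i ltin; rewrite vH // ltnW.
  by apply: memv_suml => i _; exact/vH/leqW/ltn_ord.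
have xysH i : (i < size xs)%N -> X xs`_i /\ Y ys`_i.
  by move=> lti; split; [apply/xsP/mem_nth | apply/ysP/mem_nth; rewrite -sz].
have xysbr i : (i < size xs)%N -> br xs`_i ys`_i \in H.
  by case/xysH=> Xi Yi; exact: XYH.
have halA : eta hal = \sum_(i < size xs) eta (br xs`_i ys`_i).
  by rewrite halE (sumH eta (fun i => br xs`_i ys`_i)).
have halB : alpha hal = \sum_(i < size xs) alpha (br xs`_i ys`_i).
  by rewrite halE (sumH alpha (fun i => br xs`_i ys`_i)).
(* Since [alpha hal = 2], some summand has nonzero [alpha]; it serves as the reference pair, and its
   integer [z] is the one sought. *)
have [i Bi0] : exists i : 'I_(size xs), alpha (br xs`_i ys`_i) != 0.
  apply/existsP; apply: contraT; rewrite negb_exists => /forallP B0.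
  have := halpha2; rewrite halB big1 => [/eqP|i _].
    by rewrite eq_sym pnatr_eq0.
  by apply/eqP/negPn/B0.
have [Xi Yi] := xysH i (ltn_ord i).
have [z zE] := pairing _ _ Xi Yi.
exists z.
have two0 : (2 : CC) != 0 by rewrite pnatr_eq0.
have lamE : eta (br xs`_i ys`_i) / alpha (br xs`_i ys`_i) = z%:~R / 2.
  by apply: (mulfI two0); rewrite mulrA zE mulfK // mulrC divfK.
(* Once every summand has the ratio [z / 2], summing gives [eta hal = z / 2 * alpha hal = z]. *)
rewrite halA (eq_bigr (fun j : 'I__ => z%:~R / 2 * alpha (br xs`_j ys`_j))).
  by rewrite -mulr_sumr -halB halpha2 divfK.
move=> j _; rewrite -lamE; have [Xj Yj] := xysH j (ltn_ord j).
apply: (@bilinear_proportional _ X Y (fun x y => eta (br x y))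
  (fun x y => alpha (br x y)) (rootP _) (rootP _)) => //.
- by move=> a x x' y Xx Xx' Yy; rewrite brDl // etaD //; exact: XYH.
- by move=> a x y y' Xx Yy Yy'; rewrite brDr // etaD //; exact: XYH.
- by move=> a x x' y Xx Xx' Yy; rewrite brDl // alphaD //; exact: XYH.
- by move=> a x y y' Xx Yy Yy'; rewrite brDr // alphaD //; exact: XYH.
- move=> x y Xx Yy B0; have [z' ] := pairing _ _ Xx Yy.
  by rewrite B0 mulr0 => /eqP; rewrite mulf_eq0 (negPf two0) => /eqP.
Qed.
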